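(* Let $R$ be a complete discrete valuation ring of equal characteristic with maximal ideal $\mathfrak{p}$ and finite residue field $k=R/\mathfrak{p}$ with $|k|>9$, and let $n\ge2$. Let $H$ be a closed subgroup of $\mathrm{SL}_n(R)$ such that $H^{[0]}=\mathrm{SL}_n(k)$ and $H^{[1]}$ contains a non-scalar matrix. Then $H=\mathrm{SL}_n(R)$.
   Context: For a subgroup $H\subset\mathrm{GL}_n(R)$ and $i\ge0$ let $H^i=\{h\in H: h\equiv\mathrm{Id}_n \bmod \mathfrak{p}^i\}$ and $H^{[i]}=H^i/H^{i+1}$. $H^{[0]}$ is identified with the image of $H$ in $\mathrm{GL}_n(k)$, and for $i>0$, $H^{[i]}$ is identified with a subgroup of $\mathfrak{gl}_n(\mathfrak{p}^i/\mathfrak{p}^{i+1})$ via $[\mathrm{Id}_n+X]\mapsto[X]$. Topology is the one induced by $R$. *)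

(* Defs.v *)
From HB Require Import structures.
From mathcomp Require Import all_boot all_order all_algebra.
Set Implicit Arguments. Unset Strict Implicit. Unset Printing Implicit Defensive.
Import GRing.Theory.
Local Open Scope ring_scope.

Definition in_pow (R : comNzRingType) (pi : R) (i : nat) (x : R) : Prop :=
  exists r : R, x = pi ^+ i * r.

Definition DVR_uniformizer (R : idomainType) (pi : R) : Prop :=
  [/\ pi != 0, pi \isn't a GRing.unit &
      forall x : R, x != 0 -> exists (u : R) (k : nat), u \is a GRing.unit /\ x = u * pi ^+ k].

Definition p_complete (R : idomainType) (pi : R) : Prop :=
  forall a : nat -> R,
    (forall i, exists N, forall m, (N <= m)%N -> in_pow pi i (a m - a N)) ->
    exists L : R, forall i, exists N, forall m, (N <= m)%N -> in_pow pi i (a m - L).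

Definition mx_cong (R : comNzRingType) (pi : R) (n : nat) (i : nat) (A B : 'M[R]_n) : Prop :=
  forall r c, in_pow pi i (A r c - B r c).

Definition subgroup_SL (R : idomainType) (n : nat) (H : 'M[R]_n -> Prop) : Prop :=
  [/\ forall h, H h -> \det h = 1,
      H 1%:M,
      forall g h, H g -> H h -> H (g *m h) &
      forall h, H h -> H (invmx h)].

Definition closed_in_SL (R : idomainType) (pi : R) (n : nat) (H : 'M[R]_n -> Prop) : Prop :=
  forall A : 'M[R]_n, \det A = 1 ->
    (forall i, exists h, H h /\ mx_cong pi i h A) -> H A.

Definition level0_is_SL (R : idomainType) (k : fieldType) (red : {rmorphism R -> k})
  (n : nat) (H : 'M[R]_n -> Prop) : Prop :=
  forall B : 'M[k]_n, \det B = 1 <-> exists h, H h /\ map_mx red h = B.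

(* H^{[1]} contains a non-scalar matrix: there is h in H with h = Id + X, X in M_n(p),
   such that the class [X] in gl_n(p/p^2) is not a scalar matrix [c] Id with c in p. *)
Definition level1_nonscalar (R : idomainType) (pi : R) (n : nat) (H : 'M[R]_n -> Prop) : Prop :=
  exists h, [/\ H h, mx_cong pi 1 h 1%:M &
    ~ (exists c : R, in_pow pi 1 c /\ mx_cong pi 2 (h - 1%:M) c%:M)].

(* Main.v *)
Require Import Defs.
From HB Require Import structures.
From mathcomp Require Import all_boot all_order all_algebra all_fingroup ring.
Set Implicit Arguments. Unset Strict Implicit. Unset Printing Implicit Defensive.
Import GRing.Theory.
Local Open Scope ring_scope.

(** Every graded piece H^[i] with i > 0 is an additive subgroup of M_n(k) stable
    under conjugation by SL_n(k); as soon as such a subgroup contains a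
    non-scalar matrix, conjugation by transvections shows that it contains
    sl_n(k).  A commutator of elements of levels i and j has level i + j and
    class [X, Y], so the inclusion of sl_n(k) in H^[1] propagates to all levels
    whenever sl_n(k) has a non-scalar bracket, that is unless n = 2 and char k
    = 2. In the exceptional case the identity lies in sl_2(k) and the
    determinant condition forces a lift d = (1 + pi) Id + pi^2 E in H of the
    class Id in H^[1] to satisfy tr E = 1 mod p; thus E is not scalar and
    behaves like an element of level 2 that lies outside sl_2: commutators of
    d with H^[0] fill H^[2], and commutators of d with H^[i] fill H^[i+2].
    Successive approximation then shows that H is dense in SL_n(R). *)

(** * Elementary matrices and transvections *)

Lemma delta_mulmxE (R : comNzRingType) n (i j : 'I_n) (X : 'M[R]_n) r c :
  (delta_mx i j *m X) r c = (r == i)%:R * X j c.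
Proof.
rewrite mxE (bigD1 j) //= big1 ?addr0 => [|l /negPf lj]; rewrite mxE ?eqxx ?andbT //.
by rewrite lj andbF mul0r.
Qed.

Lemma mulmx_deltaE (R : comNzRingType) n (i j : 'I_n) (X : 'M[R]_n) r c :
  (X *m delta_mx i j) r c = X r i * (c == j)%:R.
Proof.
rewrite mxE (bigD1 i) //= big1 ?addr0 => [|l /negPf li]; rewrite mxE ?eqxx //.
by rewrite li mulr0.
Qed.

Lemma det_transvection (R : comNzRingType) n (i j : 'I_n) (a : R) :
  i != j -> \det (1%:M + a *: delta_mx i j) = 1.
Proof.
wlog lt_ji : i j / (j < i)%N => [IH ij|].
  have := ij; rewrite -(inj_eq val_inj) neq_ltn /= => /orP[lt|/IH]; last exact.
  rewrite -det_tr linearD linearZ /= trmx1 trmx_delta; apply: IH => //.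
  by rewrite eq_sym.
move=> ij; rewrite det_trig.
  rewrite big1 // => l _; rewrite !mxE eqxx.
  case: eqP => [->|] /=; last by rewrite mulr0 addr0.
  by rewrite (negPf ij) mulr0 addr0.
apply/is_trig_mxP => r c lt_rc; rewrite !mxE.
have /negPf -> : r != c by rewrite -(inj_eq val_inj) neq_ltn lt_rc.
case: eqP => [ri|]; case: eqP => [cj|]; rewrite ?mulr0 ?addr0 //=.
by move: lt_rc; rewrite ri cj ltnNge ltnW.
Qed.

Lemma transvection_mulV (R : comNzRingType) n (i j : 'I_n) (a : R) : i != j ->
  (1%:M + a *: delta_mx i j) *m (1%:M - a *: delta_mx i j) = 1%:M.
Proof.
move=> ij; rewrite mulmxBr !mulmxDl !mul1mx mulmx1 -scalemxAl -scalemxAr.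
by rewrite mul_delta_mx_0 1?eq_sym // !scaler0 addr0 addrK.
Qed.

(** * Additive subgroups of [M_n(k)] stable under conjugation by [SL_n(k)] *)

Section StableSubgroups.
Variables (k : fieldType) (n : nat) (M : 'M[k]_n -> Prop).
Hypothesis MB : forall X Y, M X -> M Y -> M (X - Y).
Hypothesis MJ : forall g h X,
  \det g = 1 -> g *m h = 1%:M -> M X -> M (g *m X *m h).

Lemma stableD X Y : M X -> M Y -> M (X + Y).
Proof.
move=> mX mY; have m0 : M 0 by rewrite -(subrr X); exact: MB.
by rewrite -[Y]opprK -[- Y]add0r; apply: MB => //; apply: MB.
Qed.

(** This is the conjugate of [X] by [1 + a E_ij], minus [X]; the quadratic term comes from
    [E_ij X E_ij = X_ji E_ij]. *)
Lemma stable_transvection i j a X : i != j -> M X ->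
  M (a *: (delta_mx i j *m X - X *m delta_mx i j)
     - (a ^+ 2 * X j i) *: delta_mx i j).
Proof.
move=> ij mX.
have := MB (MJ (det_transvection a ij) (transvection_mulV a ij) mX) mX.
congr M; apply/matrixP => r c.
rewrite mulmxBr mulmx1 -scalemxAr mulmxDl mul1mx -scalemxAl.
rewrite !(mulmxDl, delta_mulmxE, mulmx_deltaE, mxE).
by case: (r == i); case: (c == j); rewrite /=; ring.
Qed.

Hypothesis k_gt2 : exists2 s : k, s != 0 & s != 1.

(** Up to sign, [c E_al] is the bracket of [c E_ab] with [E_bl]; the quadratic term vanishes because
    the [(l, b)] entry of [E_ab] is 0. *)
Lemma root_col a b l : a != b -> l != a -> l != b ->
  (forall c, M (c *: delta_mx a b)) -> forall c, M (c *: delta_mx a l).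
Proof.
move=> ab la lb Mab c; rewrite eq_sym in lb; have := stable_transvection (-1) lb (Mab c).
congr M; apply/matrixP => r d; rewrite !(delta_mulmxE, mulmx_deltaE, mxE).
rewrite eqxx andbT (negPf la) ?andbF /=.
by case: (r == a); case: (d == l) => /=; ring.
Qed.

Lemma root_row a b l : a != b -> l != a -> l != b ->
  (forall c, M (c *: delta_mx a b)) -> forall c, M (c *: delta_mx l b).
Proof.
move=> ab la lb Mab c; have := stable_transvection 1 la (Mab c).
congr M; apply/matrixP => r d; rewrite !(delta_mulmxE, mulmx_deltaE, mxE).
rewrite !eqxx (negPf lb) ?andbF /=.
by case: (r == l); case: (d == b) => /=; ring.
Qed.

(** Conjugation of [c E_ab] by [1 + s E_ba] moves it linearly in [s] along the coroot and
    quadratically along [E_ba]; varying [s] separates the two. *)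
Lemma stable_coroot a b s c : a != b ->
  (forall c, M (c *: delta_mx a b)) ->
  M ((s * c) *: (delta_mx b b - delta_mx a a) - (s ^+ 2 * c) *: delta_mx b a).
Proof.
move=> ab Mab; rewrite eq_sym in ab; have := stable_transvection s ab (Mab c).
congr M; apply/matrixP => r d; rewrite !(delta_mulmxE, mulmx_deltaE, mxE).
rewrite !eqxx /=.
by case: (r == a); case: (d == b); case: (r == b); case: (d == a) => /=; ring.
Qed.

Lemma root_opp a b : a != b ->
  (forall c, M (c *: delta_mx a b)) -> forall c, M (c *: delta_mx b a).
Proof.
move=> ab Mab c; have [s s0 s1] := k_gt2.
have s1' : 1 - s != 0 by rewrite subr_eq0 eq_sym.
(* Both linear parts have coefficient [c / (1 - s)] and cancel; the quadratic parts leave exactly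
   [c E_ba]. *)
have := MB (stable_coroot s (c / (1 - s) / s) ab Mab)
           (stable_coroot 1 (c / (1 - s)) ab Mab).
congr M; apply/matrixP => r d; rewrite !mxE.
by field; rewrite s1' s0.
Qed.

Lemma root_all a b : a != b -> (forall c, M (c *: delta_mx a b)) ->
  forall i j, i != j -> forall c, M (c *: delta_mx i j).
Proof.
have move_col a' b' j : a' != b' -> j != a' ->
    (forall c, M (c *: delta_mx a' b')) -> forall c, M (c *: delta_mx a' j).
  by move=> ab' ja'; have [->//|jb'] := eqVneq j b'; exact: root_col.
move=> ab Mab i j; have [->|ib] := eqVneq i b => ij.
  by apply: (move_col _ a); rewrite 1?eq_sym //; exact: root_opp.
apply: (move_col _ b) => //; first by rewrite eq_sym.
by have [->//|ia] := eqVneq i a; exact: (root_row ab).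
Qed.

Lemma stable_sl a b : a != b -> (forall c, M (c *: delta_mx a b)) ->
  forall Y, \tr Y = 0 -> M Y.
Proof.
move=> ab Mab Y trY; have Mroot := root_all ab Mab.
have M0 : M 0 by rewrite -(scale0r (delta_mx a b)).
(* The correction adds up to [\tr Y] times [E_aa], which is 0, and makes every summand a root or a
   coroot element. *)
have -> : Y = \sum_i \sum_j Y i j *:
    (delta_mx i j - (i == j)%:R *: delta_mx a a).
  under eq_bigr => i _.
    under eq_bigr => j _ do rewrite scalerBr.
    rewrite sumrB (bigD1 i) //= [X in _ - X](bigD1 i) //= eqxx scale1r.
    rewrite [X in _ - (_ + X)]big1 ?addr0; last first.
      by move=> j ji; rewrite eq_sym (negPf ji) scale0r scaler0.
    rewrite -(bigD1 (P := xpredT) (F := fun j => Y i j *: delta_mx i j) i) //=.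
    over.
  rewrite sumrB -matrix_sum_delta -scaler_suml.
  by rewrite -[X in X *: _]/(\tr Y) trY scale0r subr0.
apply: big_ind => //; first exact: stableD.
move=> i _; apply: big_ind => //; first exact: stableD.
move=> j _; have [<-|ij] := eqVneq i j; last first.
  by rewrite scale0r subr0; apply: Mroot.
rewrite scale1r; have [->|ia] := eqVneq i a; first by rewrite subrr scaler0.
rewrite eq_sym in ia; have Mai := Mroot _ _ ia.
(* The added multiple of [E_ia] cancels the quadratic part of the coroot element. *)
have := stableD (stable_coroot 1 (Y i i) ia Mai) (Mroot i a _ (Y i i)).
rewrite eq_sym ia => /(_ isT); congr M; apply/matrixP => r d; rewrite !mxE.
by ring.
Qed.

Lemma nonscalar_entry (X : 'M[k]_n) : (0 < n)%N -> (forall c, X <> c%:M) ->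
  (exists i j, i != j /\ X j i != 0) \/
  ((forall i j, i != j -> X i j = 0) /\ exists i j, X i i != X j j).
Proof.
move=> n_gt0 nsX.
have [/existsP[i /existsP[j /andP[ij Xji]]]|noff] :=
  boolP [exists i, exists j, (i != j) && (X j i != 0)]; [left|right].
  by exists i, j.
have diag i j : i != j -> X i j = 0.
  move=> ij; apply/eqP; apply: contraNT noff => Xij.
  by apply/existsP; exists j; apply/existsP; exists i; rewrite eq_sym ij.
split=> //.
have [/existsP[i /existsP[j Xij]]|cst] :=
  boolP [exists i, exists j, X i i != X j j]; first by exists i, j.
case: (nsX (X (Ordinal n_gt0) (Ordinal n_gt0))); apply/matrixP => i j.
rewrite !mxE; have [<-|/diag//] := eqVneq i j.
apply/eqP; apply: contraNT cst => neq.
by apply/existsP; exists i; apply/existsP; exists (Ordinal n_gt0).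
Qed.

Hypothesis k_sqr : (2%:R : k) = 0 -> forall x : k, exists y, x = y ^+ 2.

(** It suffices to reach all multiples of one [E_ij]. For diagonal [X] a transvection acts linearly
    in its parameter. Otherwise a second difference isolates the quadratic term, and in
    characteristic 2, where that difference vanishes, three successive transvections replace it. *)
Lemma stable_nonscalar_sl (X : 'M[k]_n) : (1 < n)%N -> M X ->
  (forall c, X <> c%:M) -> forall Y, \tr Y = 0 -> M Y.
Proof.
move=> n_gt1 MX /(nonscalar_entry (ltnW n_gt1))[[i [j [ij Xji]]]|]; last first.
  move=> [diag [i [j Xij]]].
  have ij : i != j by apply: contraNneq Xij => ->.
  apply: (stable_sl ij) => c.
  have d0 : X j j - X i i != 0 by rewrite subr_eq0 eq_sym.
  have := stable_transvection (c / (X j j - X i i)) ij MX.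
  congr M; apply/matrixP => r d; rewrite !(delta_mulmxE, mulmx_deltaE, mxE).
  rewrite (diag j i) 1?eq_sym //.
  have [->|ri] := eqVneq r i; have [->|dj] := eqVneq d j => /=.
  - by field.
  - by rewrite (diag j d) 1?eq_sym //; ring.
  - by rewrite (diag r i) //; ring.
  - by ring.
have [two0|two0] := eqVneq (2%:R : k) 0; last first.
  apply: (stable_sl ij) => c; pose a := c / (2%:R * X j i).
  (* For [q(a) = a L - a^2 Q] one has [q(a) + q(1) - q(a + 1) = 2 a Q], here with
     [Q = X_ji E_ij]. *)
  have := MB (stableD (stable_transvection a ij MX) (stable_transvection 1 ij MX))
             (stable_transvection (a + 1) ij MX).
  congr M; apply/matrixP => r d; rewrite !(delta_mulmxE, mulmx_deltaE, mxE) /a.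
  by case: (r == i); case: (d == j) => /=; field; rewrite Xji two0.
have := n_gt1; rewrite leq_eqVlt => /orP[/eqP n2|n_gt2].
  have cover r : r != i -> r = j.
    move=> ri; apply/eqP; apply: contraT => rj.
    have := max_card [set r; i; j]; rewrite card_ord -setUA cardsU1 !inE.
    by rewrite negb_or ri rj cards2 ij -n2.
  have [s0 s0_neq0 s0_neq1] := k_gt2.
  (* [v] is the [(i, j)] entry after the first transvection. With [d = X_jj - X_ii] nonzero, the
     second choice of [a] gives [v = s0 (1 - s0) d^2 / X_ji]. *)
  have [a v0] : exists a, a * (X j j - X i i) - a ^+ 2 * X j i != 0.
    have [d0|d0] := eqVneq (X j j - X i i) 0.
      exists 1; rewrite d0 mulr0 sub0r oppr_eq0.
      by rewrite mulf_neq0 ?expf_neq0 ?oner_neq0.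
    exists (s0 * (X j j - X i i) / X j i).
    rewrite [X in X != 0](_ : _ = s0 * (1 - s0) * (X j j - X i i) ^+ 2 / X j i);
      last by field.
    by rewrite !mulf_neq0 ?invr_neq0 ?expf_neq0 // subr_eq0 eq_sym.
  set v := _ - _ in v0.
  have eq_mod2 (x y z : k) : x - y = 2%:R * z -> x = y.
    by rewrite two0 mul0r => /subr0_eq.
  (* Modulo 2 the three transvections produce [s^2 v t (1 + t E_ij)]; since every element is a
     square, the scalar factor is arbitrary. *)
  have Mborel c t : t != 0 -> M (c *: (1%:M + t *: delta_mx i j)).
    move=> t0; have [s cE] := k_sqr two0 (c / (v * t)).
    have ji : j != i by rewrite eq_sym.
    have := stable_transvection t ij
      (stable_transvection s ji (stable_transvection a ij MX)).
    have -> : c = s ^+ 2 * v * t by rewrite -cE; field; rewrite t0.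
    congr M; apply/matrixP => r d.
    rewrite !(delta_mulmxE, mulmx_deltaE, mxE).
    rewrite !eqxx (negPf ij) (negPf ji) /v.
    have [->|/cover ->] := eqVneq r i; have [->|/cover ->] := eqVneq d i;
    rewrite ?eqxx ?(negPf ij) ?(negPf ji) /=.
    - by apply: (eq_mod2 _ _ (s * a * t * X j i - s ^+ 2 * v * t)); rewrite /v; ring.
    - by apply: (eq_mod2 _ _ (t * s * v - t ^+ 2 * s * a * X j i)); rewrite /v; ring.
    - by ring.
    - by apply: (eq_mod2 _ _ (- (s * a * t * X j i))); rewrite /v; ring.
  apply: (stable_sl ij) => c.
  have s01 : 1 - s0 != 0 by rewrite subr_eq0 eq_sym.
  (* Two values of [t] with the same scalar factor: the identity parts cancel. *)
  have := MB (Mborel (c / (1 - s0)) 1 (oner_neq0 _)) (Mborel (c / (1 - s0)) s0 s0_neq0).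
  congr M; apply/matrixP => r d; rewrite !mxE.
  by field.
have [l li lj] : exists2 l, l != i & l != j.
  have /card_gt0P[l] : (0 < #|~: [set i; j]|)%N.
    by rewrite cardsCs setCK cards2 ij card_ord subn_gt0.
  by rewrite !inE negb_or => /andP[]; exists l.
apply: (stable_sl ij) => c; pose a := c / X j i.
have il : i != l by rewrite eq_sym.
(* With a third index [l], the second step leaves only entries in row [i], at columns [j] and [l];
   the third turns the latter into [a X_ji E_ij]. *)
have := stable_transvection 1 lj
  (stable_transvection 1 il (stable_transvection a ij MX)).
congr M; apply/matrixP => r d; rewrite !(delta_mulmxE, mulmx_deltaE, mxE) /a.
have ji : (j == i) = false by rewrite eq_sym (negPf ij).
have jl : (j == l) = false by rewrite eq_sym (negPf lj).
have il' := negPf il; rewrite !eqxx ?ji ?jl ?il' ?(negPf ij) ?(negPf li) ?(negPf lj).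
rewrite ?andbF /=.
have [->|ri] := eqVneq r i; last have [->|rl] := eqVneq r l;
  (have [->|dj] := eqVneq d j; last have [->|dl] := eqVneq d l);
  rewrite ?eqxx ?ji ?jl ?il' ?(negPf li) ?(negPf lj) /=.
all: by field.
Qed.

End StableSubgroups.


(** * Determinant expansions *)

Lemma det_1addZ (R : comNzRingType) n (t : R) (X : 'M[R]_n) :
  exists r, \det (1%:M + t *: X) = 1 + t * \tr X + t ^+ 2 * r.
Proof.
pose P (x : R) := exists r, x = t ^+ 2 * r.
have P0 : P 0 by exists 0; rewrite mulr0.
have PD x y : P x -> P y -> P (x + y).
  by move=> [r ->] [q ->]; exists (r + q); rewrite mulrDr.
rewrite /determinant (bigD1 (1 : 'S_n)%g) //= odd_perm1 mul1r.
have [r1 ->] : exists r, \prod_i (1%:M + t *: X) i ((1 : 'S_n)%g i)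
    = 1 + t * \tr X + t ^+ 2 * r.
  rewrite /mxtrace; elim/big_rec2: _ => [|i y x _ [r ->]].
    by exists 0; rewrite !mulr0 !addr0.
  exists (r + X i i * y + t * X i i * r); rewrite perm1 !mxE eqxx mulr1n.
  by ring.
suff [r2 ->] : P (\sum_(s : 'S_n | s != 1%g) (-1) ^+ s * \prod_i (1%:M + t *: X) i (s i)).
  by exists (r1 + r2); rewrite mulrDr addrA.
apply: big_ind => // s s1.
(* A permutation moving [i] also moves [s i], so its product has two off-diagonal factors, each
   divisible by [t]. *)
have [i si] : exists i, s i != i.
  apply/existsP; apply: contraNT s1 => /existsPn fix_s.
  by apply/eqP/permP => i; rewrite perm1; apply/eqP; have := fix_s i; rewrite negbK.
have ssi : s (s i) != s i by rewrite (inj_eq perm_inj).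
rewrite (bigD1 i) //= (bigD1 (s i)) //= !mxE.
rewrite [i == _]eq_sym [s i == s (s i)]eq_sym (negPf si) (negPf ssi).
rewrite !mulr0n !add0r.
move: (\prod_(_ | _) _) ((-1) ^+ s) (X i _) (X (s i) _) => q e x y.
by exists (e * (x * y) * q); ring.
Qed.

Lemma mxtrace2 (R : comNzRingType) n (i j : 'I_n) (X : 'M[R]_n) :
  n = 2%N -> i != j -> \tr X = X i i + X j j.
Proof.
move=> n2 ij; subst n; rewrite /mxtrace (bigD1 i) //= (bigD1 j) 1?eq_sym //=.
rewrite big_pred0 ?addr0 // => l.
by move: i j l ij; do 3!case=> [[|[|//]] ?].
Qed.

Lemma det_scalar_addZ2 (R : comNzRingType) n (a t : R) (X : 'M[R]_n) :
  n = 2%N -> \det (a%:M + t *: X) = a ^+ 2 + a * t * \tr X + t ^+ 2 * \det X.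
Proof.
move=> n2; subst n; rewrite (mxtrace2 (i := 0) (j := 1)) //.
rewrite !(expand_det_row _ 0) !big_ord_recl !big_ord0 /cofactor !det_mx11 !mxE /=.
have -> : lift (0 : 'I_2) (0 : 'I_1) = 1 by exact: val_inj.
have -> : lift (1 : 'I_2) (0 : 'I_1) = 0 by exact: val_inj.
by rewrite -[ord0]/(0 : 'I_2); ring.
Qed.

(** * The graded pieces of [H] and their commutators *)

Section GradedPieces.
Variables (R : idomainType) (pi : R) (k : finFieldType) (red : {rmorphism R -> k}).
Variables (n : nat) (H : 'M[R]_n -> Prop).
Hypothesis red_ker : forall x : R, red x = 0 <-> in_pow pi 1 x.
Hypothesis subH : subgroup_SL H.

(** For [i > 0] this is [H^[i]], with [p^i/p^(i+1)] identified with [k] through division by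
    [pi ^+ i]. *)
Definition graded_piece (i : nat) (Y : 'M[k]_n) : Prop :=
  exists h X, [/\ H h, h = 1%:M + pi ^+ i *: X & map_mx red X = Y].

Lemma red_pi : red pi = 0.
Proof. by apply/red_ker; exists 1; rewrite mulr1. Qed.

Lemma mx_congP i (A B : 'M[R]_n) :
  mx_cong pi i A B <-> exists X, A = B + pi ^+ i *: X.
Proof.
split=> [cAB|[X -> r c]]; last by exists (X r c); rewrite !mxE [B r c + _]addrC addrK.
have [f fE] := fin_all_exists (fun r => fin_all_exists (fun c => cAB r c)).
exists (\matrix_(r, c) f r c); apply/matrixP => r c.
by rewrite !mxE -fE addrC subrK.
Qed.

Lemma red_mx_eq0 (X : 'M[R]_n) : map_mx red X = 0 -> exists Z, X = pi *: Z.
Proof.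
move=> X0; have [|Z ->] := (mx_congP 1 X 0).1; last by exists Z; rewrite add0r.
by move=> r c; rewrite mxE subr0; apply/red_ker; move/matrixP/(_ r c): X0; rewrite !mxE.
Qed.

Lemma subgroup_unit h : H h -> h \in unitmx.
Proof. by case: subH => det1 _ _ _ /det1; rewrite unitmxE => ->; exact: unitr1. Qed.

Lemma red_mxV h : H h -> map_mx red h *m map_mx red (invmx h) = 1%:M.
Proof. by move=> Hh; rewrite -map_mxM mulmxV ?map_mx1 ?subgroup_unit. Qed.

Lemma red_1addZ i (X : 'M[R]_n) : (0 < i)%N -> map_mx red (1%:M + pi ^+ i *: X) = 1%:M.
Proof.
case: i => // i _; rewrite map_mxD map_mx1 map_mxZ rmorphXn /= red_pi.
by rewrite expr0n scale0r addr0.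
Qed.

Lemma red_inv1 h : H h -> map_mx red h = 1%:M -> map_mx red (invmx h) = 1%:M.
Proof. by move=> /red_mxV + h1; rewrite h1 mul1mx. Qed.

(** Uses [g h g^-1 h^-1 = 1 + (g h - h g) g^-1 h^-1]. The factors need not be congruent to 1, so
    commutators with level 0 are covered too. *)
Lemma graded_commutator g h m Z : H g -> H h ->
  g *m h - h *m g = pi ^+ m *: Z ->
  graded_piece m (map_mx red Z *m map_mx red (invmx g) *m map_mx red (invmx h)).
Proof.
move=> Hg Hh ghZ; have [_ _ HM HV] := subH.
exists (g *m h *m invmx g *m invmx h), (Z *m invmx g *m invmx h); split.
- exact: (HM _ _ (HM _ _ (HM _ _ Hg Hh) (HV _ Hg)) (HV _ Hh)).
- rewrite !scalemxAl -ghZ mulmxBl mulmxBl -[h *m g *m invmx g]mulmxA.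
  by rewrite mulmxV ?subgroup_unit // mulmx1 mulmxV ?subgroup_unit // addrC subrK.
- by rewrite !map_mxM.
Qed.

(** Here [g h^-1 = 1 + (g - h) h^-1], and [h^-1] reduces to 1. *)
Lemma gradedB i Y Z : (0 < i)%N ->
  graded_piece i Y -> graded_piece i Z -> graded_piece i (Y - Z).
Proof.
move=> i_gt0 [g [X [Hg gE <-]]] [h [W [Hh hE <-]]]; have [_ _ HM HV] := subH.
exists (g *m invmx h), ((X - W) *m invmx h); split.
- by apply: HM => //; exact: HV.
- have ghE : pi ^+ i *: (X - W) = g - h.
    by rewrite scalerBr gE hE opprD addrACA subrr add0r.
  by rewrite scalemxAl ghE mulmxBl mulmxV ?subgroup_unit // addrC subrK.
- by rewrite map_mxM (red_inv1 Hh) ?mulmx1 ?map_mxB // hE red_1addZ.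
Qed.

Lemma gradedJ i Y g g' : level0_is_SL red H ->
  \det g = 1 -> g *m g' = 1%:M -> graded_piece i Y -> graded_piece i (g *m Y *m g').
Proof.
move=> lev0 /lev0[a [Ha <-]] aV [h [X [Hh hE <-]]]; have [_ _ HM HV] := subH.
have -> : g' = map_mx red (invmx a).
  rewrite -[g']mul1mx -(mulmx1C (red_mxV Ha)) -mulmxA aV mulmx1 //.
exists (a *m h *m invmx a), (a *m X *m invmx a); split; last by rewrite !map_mxM.
- exact: (HM _ _ (HM _ _ Ha Hh) (HV _ Ha)).
- rewrite hE mulmxDr mulmxDl mulmx1 mulmxV ?subgroup_unit //.
  by rewrite -scalemxAr -scalemxAl.
Qed.

Lemma graded_lie i j Y Z : (0 < i)%N -> (0 < j)%N ->
  graded_piece i Y -> graded_piece j Z -> graded_piece (i + j) (Y *m Z - Z *m Y).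
Proof.
move=> i_gt0 j_gt0 [g [X [Hg gE <-]]] [h [W [Hh hE <-]]].
have := @graded_commutator g h (i + j) (X *m W - W *m X) Hg Hh.
rewrite (red_inv1 Hg) ?(red_inv1 Hh) ?gE ?hE ?red_1addZ // !mulmx1 !map_mxB !map_mxM.
apply; apply/matrixP => r c.
rewrite !(mulmxDl, mulmxDr, mulmx1, mul1mx) -!scalemxAl -!scalemxAr !mxE exprD.
by ring.
Qed.


(** * Propagation of [sl_n(k)] through the levels *)

Definition graded_full (i : nat) : Prop := forall Y, \tr Y = 0 -> graded_piece i Y.

Hypothesis piN0 : pi != 0.
Hypothesis eq_pchar : [pchar R] =i [pchar k].
Hypothesis k_gt2 : (2 < #|k|)%N.
Hypothesis n_gt1 : (1 < n)%N.
Hypothesis lev0 : level0_is_SL red H.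

Lemma exists_neq01 : exists2 s : k, s != 0 & s != 1.
Proof.
have /card_gt0P[s] : (0 < #|~: [set 0%R; 1%R : k]|)%N.
  by rewrite cardsCs setCK cards2 subn_gt0 eq_sym oner_neq0.
by rewrite !inE negb_or => /andP[]; exists s.
Qed.

Lemma graded_nonscalar i Y : (0 < i)%N -> graded_piece i Y ->
  (forall c, Y <> c%:M) -> graded_full i.
Proof.
move=> i_gt0 LY nsY; apply: stable_nonscalar_sl LY nsY => //.
- by move=> ? ?; exact: gradedB.
- by move=> ? ? ?; exact: gradedJ.
- exact: exists_neq01.
move=> two0 x.
(* In characteristic 2 squaring is additive, hence injective, and by finiteness of [k]
   surjective. *)
have sqr_inj : injective (fun y : k => y ^+ 2).
  move=> y z /= yz; apply/subr0_eq/eqP; rewrite -sqrf_eq0; apply/eqP.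
  rewrite (_ : _ ^+ 2 = y ^+ 2 - z ^+ 2 + 2%:R * (z ^+ 2 - y * z)); last by ring.
  by rewrite yz two0 subrr mul0r addr0.
have /codomP[y ->] : x \in codom (fun y : k => y ^+ 2).
  exact: injF_onto.
by exists y.
Qed.

Lemma delta_nonscalar (i j : 'I_n) (a : k) : i != j -> a != 0 ->
  forall c, a *: delta_mx i j <> c%:M.
Proof.
move=> ij a0 c /matrixP/(_ i j); rewrite !mxE !eqxx (negPf ij) mulr1 => a0'.
by rewrite a0' eqxx in a0.
Qed.

Lemma tr_delta (i j : 'I_n) : \tr (delta_mx i j : 'M[k]_n) = (i == j)%:R.
Proof.
rewrite /mxtrace (bigD1 i) //= mxE eqxx big1 ?addr0 // => l /negPf li.
by rewrite mxE li.
Qed.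

(** The witnesses are [[E_01, E_12] = E_02] for [n > 2] and [[E_01, E_11 - E_00] = 2 E_01]
    otherwise. *)
Lemma bracket_nonscalar : (2 < n)%N \/ (2%:R : k) != 0 ->
  exists Y Z : 'M[k]_n, [/\ \tr Y = 0, \tr Z = 0 &
    forall c, Y *m Z - Z *m Y <> c%:M].
Proof.
pose o0 := Ordinal (ltnW n_gt1); pose o1 := Ordinal n_gt1.
case=> [n_gt2|two0].
  pose o2 := Ordinal n_gt2.
  exists (delta_mx o0 o1), (delta_mx o1 o2); split; rewrite ?tr_delta //.
  rewrite mul_delta_mx mul_delta_mx_0 // subr0 -[delta_mx _ _]scale1r.
  by apply: delta_nonscalar; rewrite ?oner_neq0.
exists (delta_mx o0 o1), (delta_mx o1 o1 - delta_mx o0 o0); split.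
- by rewrite tr_delta.
- by rewrite raddfB /= !tr_delta subrr.
rewrite mulmxBr mulmxBl !mul_delta_mx !mul_delta_mx_0 // subr0 sub0r opprK.
by rewrite -mulr2n -scaler_nat; apply: delta_nonscalar.
Qed.

Lemma graded_fullS i : (2 < n)%N \/ (2%:R : k) != 0 ->
  (0 < i)%N -> graded_full 1 -> graded_full i -> graded_full i.+1.
Proof.
move=> /bracket_nonscalar[Y [Z [trY trZ ns]]] i_gt0 L1 Li.
have := graded_lie i_gt0 (ltn0Sn 0) (Li Y trY) (L1 Z trZ).
by rewrite addn1 => /graded_nonscalar; apply.
Qed.

(* Here the bracket of sl_2 takes scalar values only; E supplies a non-central
   direction outside sl_2. *)
Lemma exists_scalar_twist : n = 2%N -> (2%:R : k) = 0 -> graded_full 1 ->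
  exists d E, [/\ H d, d = (1 + pi)%:M + pi ^+ 2 *: E,
    map_mx red (invmx d) = 1%:M & \tr (map_mx red E) = 1].
Proof.
move=> n2 two0 L1.
(* The identity has trace 2, which is 0 in [k], so it is a class of level 1. *)
have [|d [D [Hd dE redD]]] := L1 1%:M; first by rewrite mxtrace1 n2.
have [|E DE] := red_mx_eq0 (X := D - 1%:M).
  by rewrite map_mxB redD map_mx1 subrr.
have {}dE : d = (1 + pi)%:M + pi ^+ 2 *: E.
  rewrite dE -[D](subrK 1%:M) DE expr1 scalerDr scalerA -expr2 raddfD /=.
  by rewrite scalemx1 -addrA [_%:M + _ *: _]addrC.
exists d, E; split=> //.
  apply: red_inv1 => //; rewrite dE map_mxD map_scalar_mx map_mxZ rmorphXn rmorphD /=.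
  by rewrite red_pi rmorph1 addr0 expr0n scale0r addr0.
have two0R : (2%:R : R) = 0.
  have : 2%N \in [pchar R] by rewrite eq_pchar inE two0 eqxx.
  by case/andP=> _ /eqP.
have [det1 _ _ _] := subH; have := det1 _ Hd.
rewrite dE (det_scalar_addZ2 _ _ _ n2).
set t := \tr E; set e := \det E => det_eq.
(* Since [(1 + pi)^2 = 1 + pi^2] in characteristic 2, the equation [\det d = 1] becomes divisible by
   [pi ^+ 2]; reducing the quotient gives [1 + \tr E = 0] in [k]. *)
have /eqP : pi ^+ 2 * (1 + (1 + pi) * t + pi ^+ 2 * e) = 0.
  transitivity (((1 + pi) ^+ 2 + (1 + pi) * pi ^+ 2 * t + pi ^+ 2 ^+ 2 * e)
                - 1 - 2%:R * pi); first by ring.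
  by rewrite det_eq two0R mul0r !subrr.
rewrite mulf_eq0 expf_eq0 (negPf piN0) andbF /= => /eqP/(congr1 red).
rewrite !(rmorphD, rmorphM, rmorph1, rmorphXn) rmorph0 /= red_pi.
rewrite addr0 mul1r expr0n mul0r addr0 trace_map_mx => /eqP.
rewrite addrC addr_eq0 => /eqP ->; apply/eqP.
by rewrite eq_sym -subr_eq0 opprK -[1 + 1]/(2%:R) two0.
Qed.

(** Modulo 2 the difference of the diagonal entries is their sum, the trace. *)
Lemma twist_entry (E : 'M[k]_n) (i j : 'I_n) : n = 2%N -> (2%:R : k) = 0 ->
  \tr E = 1 -> i != j -> E j j - E i i = 1.
Proof.
move=> n2 two0 trE ij; rewrite -trE (mxtrace2 _ n2 ij).
apply/eqP; rewrite -subr_eq0 (_ : _ - _ = - (2%:R * E i i)); last by ring.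
by rewrite two0 mul0r oppr0.
Qed.

(** The scalar part of [d] is central, so its commutator with a lift [g] of a transvection already
    has level 2, with class [g F g^-1 - F]. *)
Lemma graded_full2 : n = 2%N -> (2%:R : k) = 0 -> graded_full 1 -> graded_full 2.
Proof.
move=> n2 two0 /(exists_scalar_twist n2 two0)[d [E [Hd dE dV1 trE]]].
pose i := Ordinal (ltnW n_gt1); pose j := Ordinal n_gt1; have ij : i != j by [].
have dEE := twist_entry n2 two0 trE ij; set F := map_mx red E in trE dEE.
(* The [(i, j)] entry of the class will be [a (1 - a F_ji)]; this choice keeps it nonzero. *)
have [a a0 az] : exists2 a : k, a != 0 & a * F j i != 1.
  have [Fji|] := eqVneq (F j i) 1; last by exists 1; rewrite ?oner_neq0 ?mul1r.
  have [s s0 s1] := exists_neq01; by exists s; rewrite // Fji mulr1.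
have [g [Hg gE]] := (lev0 _).1 (det_transvection a ij).
have gVE : map_mx red (invmx g) = 1%:M - a *: delta_mx i j.
  rewrite -[LHS]mulmx1 -[X in _ *m X](transvection_mulV a ij) mulmxA -gE.
  by rewrite (mulmx1C (red_mxV Hg)) mul1mx.
have := @graded_commutator g d 2 (g *m E - E *m g) Hg Hd.
rewrite dV1 mulmx1 gVE map_mxB !map_mxM gE -/F => LZ.
apply: (graded_nonscalar _ (LZ _)) => // [|c]; last clearbody F.
  rewrite dE mulmxDr mulmxDl mul_mx_scalar mul_scalar_mx -scalemxAl -scalemxAr.
  by rewrite opprD addrACA subrr add0r scalerBr.
move/matrixP/(_ i j).
rewrite mulmxBr mulmx1 -scalemxAr mulmxDl mul1mx mulmxDr mulmx1 -scalemxAl -scalemxAr.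
rewrite !(delta_mulmxE, mulmx_deltaE, mxE) !eqxx (negPf ij) /= => eq0.
have : a * (1 - a * F j i) = 0 by rewrite -dEE -[RHS]eq0; ring.
by move/eqP; rewrite mulf_eq0 (negPf a0) subr_eq0 eq_sym (negPf az).
Qed.

(** The commutator of [d] with a lift of [E_01] at level [i] has class [[F, E_01]], whose [(0, 1)]
    entry is [F_00 - F_11 = 1]. *)
Lemma graded_fullSS i : n = 2%N -> (2%:R : k) = 0 -> (0 < i)%N ->
  graded_full 1 -> graded_full i -> graded_full i.+2.
Proof.
move=> n2 two0 i_gt0 /(exists_scalar_twist n2 two0)[d [E [Hd dE dV1 trE]]] Li.
pose i0 := Ordinal (ltnW n_gt1); pose i1 := Ordinal n_gt1.
have i01 : i0 != i1 by []; have i10 : i1 != i0 by [].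
have dEE := twist_entry n2 two0 trE i10; set F := map_mx red E in trE dEE.
have [|y [Y [Hy yE redY]]] := Li (delta_mx i0 i1); first by rewrite tr_delta.
have yV1 : map_mx red (invmx y) = 1%:M.
  by apply: red_inv1 => //; rewrite yE red_1addZ.
have := @graded_commutator d y i.+2 (E *m Y - Y *m E) Hd Hy.
rewrite dV1 yV1 !mulmx1 map_mxB !map_mxM redY -/F => LZ.
apply: (graded_nonscalar _ (LZ _)) => // [|c]; last clearbody F.
  rewrite dE yE !(mulmxDr, mulmxDl) !mulmx1 !mul1mx mul_mx_scalar.
  rewrite mul_scalar_mx -!scalemxAl -!scalemxAr; move: (E *m Y) (Y *m E) => P Q.
  apply/matrixP => r c'; by rewrite !mxE -(addn2 i) exprD; ring.
move/matrixP/(_ i0 i1); rewrite !(delta_mulmxE, mulmx_deltaE, mxE) !eqxx (negPf i01) /=.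
by rewrite mulr1 mul1r dEE mulr0n => /eqP; rewrite oner_eq0.
Qed.

Lemma graded_full_all i : (0 < i)%N -> graded_full 1 -> graded_full i.
Proof.
move=> i_gt0 L1; have [ok|] := boolP ((2 < n)%N || ((2%:R : k) != 0)).
  case: i i_gt0 => // i _; elim: i => // i IH.
  by apply: graded_fullS IH => //; apply/orP.
rewrite negb_or negbK -leqNgt => /andP[n_le2 /eqP two0].
have n2 : n = 2%N by apply/eqP; rewrite eqn_leq n_le2.
(* The twist raises the level by 2, so the induction carries two consecutive levels. *)
case: i i_gt0 => // i _; suff [] : graded_full i.+1 /\ graded_full i.+2 by [].
elim: i => [|i [IH1 IH2]]; first by split=> //; exact: graded_full2.
by split=> //; exact: graded_fullSS.
Qed.

(** * Density by successive approximation *)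

Lemma dense_SL : graded_full 1 ->
  forall A, \det A = 1 -> forall i, exists h, H h /\ mx_cong pi i h A.
Proof.
move=> L1 A detA; have [det1 H1 HM HV] := subH.
elim=> [|i [h [Hh /mx_congP[X hE]]]].
  by exists 1%:M; split=> // r c; exists (1%:M r c - A r c); rewrite mul1r.
(* Passing from modulus [p^0] to [p] uses the hypothesis on [H^[0]]; later steps correct [h] on the
   right by an element of [H] of positive level. *)
case: i hE => [|i] hE.
  have /lev0[g [Hg gA]] : \det (map_mx red A) = 1 by rewrite det_map_mx detA rmorph1.
  exists g; split=> // r c; apply/red_ker; rewrite rmorphB.
  by move/matrixP/(_ r c): gA; rewrite !mxE => ->; rewrite subrr.
pose W := - (invmx h *m X).
have WE : invmx h *m A = 1%:M + pi ^+ i.+1 *: W.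
  have -> : A = h - pi ^+ i.+1 *: X by rewrite hE addrK.
  by rewrite mulmxBr mulVmx ?subgroup_unit // scalerN scalemxAr.
(* To first order [\det (h^-1 A) = 1] says that the error term has trace 0 modulo [p], hence lies in
   [sl_n(k)]. *)
have trW : \tr (map_mx red W) = 0.
  have [r] := det_1addZ (pi ^+ i.+1) W; rewrite -WE det_mulmx detA.
  rewrite (det1 _ (HV _ Hh)) mulr1.
  rewrite -addrA => /eqP; rewrite -[X in X == _]addr0 (inj_eq (addrI _)).
  rewrite (_ : _ + _ = pi ^+ i.+1 * (\tr W + pi ^+ i.+1 * r)); last by ring.
  rewrite eq_sym mulf_eq0 expf_eq0 (negPf piN0) andbF /= => /eqP/(congr1 red).
  by rewrite rmorphD rmorphM rmorphXn rmorph0 /= red_pi expr0n mul0r addr0 trace_map_mx.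
have [g [V [Hg gE redV]]] := graded_full_all (ltn0Sn i) L1 trW.
have [|Z ZE] := red_mx_eq0 (X := V - W); first by rewrite map_mxB redV subrr.
exists (h *m g); split; first exact: HM.
apply/mx_congP; exists (h *m Z).
have {1}-> : A = h *m (invmx h *m A) by rewrite mulmxA mulmxV ?mul1mx ?subgroup_unit.
rewrite WE gE -[V](subrK W) ZE [X in _ = _ + X]scalemxAr -mulmxDr.
by congr (_ *m _); apply/matrixP => r c; rewrite !mxE (exprSr pi i.+1); ring.
Qed.

End GradedPieces.

(** * Conclusion from density and closedness *)

Theorem mainTheorem13
  (R : idomainType) (pi : R) (k : finFieldType) (red : {rmorphism R -> k})
  (n : nat) (H : 'M[R]_n -> Prop) :
  DVR_uniformizer pi ->
  p_complete pi ->
  (forall y : k, exists x : R, red x = y) ->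
  (forall x : R, red x = 0 <-> in_pow pi 1 x) ->
  [pchar R] =i [pchar k] ->
  (9 < #|k|)%N ->
  (2 <= n)%N ->
  subgroup_SL H ->
  closed_in_SL pi H ->
  level0_is_SL red H ->
  level1_nonscalar pi H ->
  forall A : 'M[R]_n, \det A = 1 -> H A.
Proof.
move=> [piN0 _ _] _ red_surj red_ker eq_pchar k_gt9 n_gt1 subH closedH lev0 lev1.
move=> A detA; apply: closedH => //.
have k_gt2 : (2 < #|k|)%N by exact: leq_trans k_gt9.
apply: (dense_SL red_ker subH piN0 eq_pchar k_gt2 n_gt1 lev0) => //.
have [h [Hh /mx_congP[X hE] ns]] := lev1.
apply: (graded_nonscalar red_ker subH k_gt2 n_gt1 lev0 (Y := map_mx red X)) => //.
  by exists h, X.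
(* If [X] reduced to the scalar [c], a lift [b] of [c] would make [h - 1] congruent to the scalar
   [pi b] modulo [p^2]. *)
move=> c Xc; apply: ns; have [b bc] := red_surj c.
exists (pi * b); split; first by exists b; rewrite expr1.
have [|Z XE] := red_mx_eq0 red_ker (X := X - b%:M).
  by rewrite map_mxB map_scalar_mx Xc /= bc subrr.
apply/mx_congP; exists Z; rewrite hE addrC addKr -[X](subrK b%:M) XE.
by rewrite expr1 scalerDr scalerA -expr2 addrC scale_scalar_mx.
Qed.
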